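(* Let $p\geq 2$ and let $G=(V,E)$ be a $2p$-regular graph on $n$ vertices. Then $G$ is $(p+2)$-star colourable if and only if $V$ can be partitioned into $(p+1)(p+2)$ sets $V_i^j$, indexed by $i,j\in\{0,1,\dots,p+1\}$ with $i\neq j$, such that for all such $i,j$, each vertex in $V_i^j$ has exactly $p$ neighbours in $\bigcup_{k\notin\{i,j\}} V_j^k$ and exactly one neighbour in $V_k^i$ for each $k\in\{0,1,\dots,p+1\}\setminus\{i,j\}$. Moreover, if $V$ can be partitioned into such sets $V_i^j$, then all sets $V_i^j$ have the same cardinality, and hence $n$ is divisible by $(p+1)(p+2)$.
   Context: All graphs are finite and simple. A $k$-colouring of $G$ is a map $f:V(G)\to\{0,\dots,k-1\}$ with $f(u)\neq f(v)$ for every edge $uv$; it is a $k$-star colouring if no path on 4 vertices in $G$ receives only two colours. $G$ is $k$-star colourable if it admits a $k$-star colouring. *)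

(* Defs.v *)
(* MathComp world. *)
From mathcomp Require Import all_boot.

Set Implicit Arguments.
Unset Strict Implicit.
Unset Printing Implicit Defensive.

Record sgraph := SGraph {
  vertex :> finType;
  adj : rel vertex;
  adj_sym : symmetric adj;
  adj_irrefl : irreflexive adj
}.

Definition neighbours (G : sgraph) (v : G) : {set G} := [set u | adj v u].

Definition regular (d : nat) (G : sgraph) : Prop :=
  forall v : G, #|neighbours v| = d.

Definition colouring (k : nat) (G : sgraph) (f : G -> 'I_k) : Prop :=
  forall u v : G, adj u v -> f u != f v.

(* Paths are subgraphs of G, not necessarily induced. *)
Definition is_P4 (G : sgraph) (a b c d : G) : bool :=
  uniq [:: a; b; c; d] && path (@adj G) a [:: b; c; d].

Definition star_colouring (k : nat) (G : sgraph) (f : G -> 'I_k) : Prop :=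
  colouring f /\
  forall a b c d : G, is_P4 a b c d ->
    ~ (#|[set f x | x in [:: a; b; c; d]]| <= 2).

Definition star_colourable (k : nat) (G : sgraph) : Prop :=
  exists f : G -> 'I_k, star_colouring f.

(* An indexed partition (V i j), i != j, of the vertex set; the diagonal values
   V i i are junk and never used.  Empty parts are not excluded here, so that
   the graph without vertices is covered. *)
Definition offdiag_partition (G : sgraph) (q : nat)
    (V : 'I_q -> 'I_q -> {set G}) : Prop :=
  (forall i j i' j' : 'I_q, i != j -> i' != j' -> (i, j) != (i', j') ->
     [disjoint V i j & V i' j']) /\
  \bigcup_(i < q) \bigcup_(j < q | i != j) V i j = [set: G].

(* V i j stands for V_i^j. *)
Definition star_partition (p : nat) (G : sgraph)
    (V : 'I_p.+2 -> 'I_p.+2 -> {set G}) : Prop :=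
  offdiag_partition V /\
  forall i j : 'I_p.+2, i != j -> forall v : G, v \in V i j ->
    #|neighbours v :&: \bigcup_(k | k \notin [:: i; j]) V j k| = p /\
    forall k : 'I_p.+2, k \notin [:: i; j] ->
      #|neighbours v :&: V k i| = 1.

(* Main.v *)
Require Import Defs.
From mathcomp Require Import all_boot.
From mathcomp Require Import zify.

(** In a star colouring every bicoloured component is a star, so each edge [vu]
    has an end that sees the colour of the other end exactly once.  If [v] sees
    [a v] colours exactly once, counting edges gives [\sum_v a v >= p n], while
    [a v <= p] as [2 p > p + 1].  Hence [a v = p], each edge is counted from
    exactly one end, and the other [p] neighbours of [v] share one colour [s v];
    put [v] into [V (f v) (s v)].  For the cardinalities, counting the edges
    between [V k i] and the class of colour [i] gives
    [S i = #|V i k| + p * #|V k i|], where [S i] is the size of that class; this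
    linear system forces all the [#|V i k|] to be equal. *)

(** * Finite sums and double counting *)

Lemma eq_of_leq_sum {I : finType} (F1 F2 : I -> nat) :
  (forall i, F1 i <= F2 i) -> \sum_i F2 i <= \sum_i F1 i ->
  forall i, F1 i = F2 i.
Proof.
move=> le12 le21 i; apply/eqP.
have [_] := leqif_sum (fun i (_ : true) => leqif_eq (le12 i)).
by rewrite eqn_leq le21 leq_sum // => /esym/forall_inP; apply.
Qed.

Lemma card_partition_sum {T I : finType} (f : T -> I) (A : {set T}) :
  #|A| = \sum_i #|[set x in A | f x == i]|.
Proof.
rewrite -sum1_card (partition_big f predT) //=; apply: eq_bigr => i _.
by rewrite -sum1_card; apply: eq_bigl => x; rewrite inE.
Qed.

Lemma exchange_card {T U : finType} (r : T -> U -> bool)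
    (A : {set T}) (B : {set U}) :
  \sum_(x in A) #|[set y in B | r x y]| = \sum_(y in B) #|[set x in A | r x y]|.
Proof.
transitivity (\sum_(x in A) \sum_(y in B) r x y).
  apply: eq_bigr => x _; rewrite -sum1_card big_mkcond [RHS]big_mkcond.
  by apply: eq_bigr => y _; rewrite inE; case: (y \in B); case: (r x y).
rewrite exchange_big; apply: eq_bigr => y _.
rewrite -sum1_card big_mkcond [RHS]big_mkcond.
by apply: eq_bigr => x _; rewrite inE; case: (x \in A); case: (r x y).
Qed.

Lemma card_ord_neq2 {p : nat} {i j : 'I_p.+2} :
  i != j -> #|[set k : 'I_p.+2 | k \notin [:: i; j]]| = p.
Proof.
move=> ij; have := cardsC [set i; j]; rewrite cards2 ij card_ord add2n.
by case=> cardC; rewrite -[RHS]cardC; apply: eq_card => k; rewrite !inE.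
Qed.

(** * Uniquely seen neighbours in a star colouring *)

Definition colour_neighbours {G : sgraph} {k : nat} (f : G -> 'I_k)
    (v : G) (j : 'I_k) : {set G} :=
  [set u in neighbours v | f u == j].

(** Otherwise [v] has a second neighbour [w] of colour [f u] and [u] a second neighbour [x] of
    colour [f v], so that [x u v w] is a bicoloured path. *)
Lemma star_colouring_edge {G : sgraph} {k : nat} {f : G -> 'I_k} {u v : G} :
  star_colouring f -> adj v u ->
  #|colour_neighbours f v (f u)| <= 1 \/ #|colour_neighbours f u (f v)| <= 1.
Proof.
move=> [fP4 fP] vu.
case: (leqP #|colour_neighbours f v (f u)| 1) => [|lt1v]; first by left.
right; rewrite leqNgt; apply/negP => lt1u.
have uv : adj u v by rewrite adj_sym.
have /card_gt0P[w] : 0 < #|colour_neighbours f v (f u) :\ u|.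
  by move: lt1v; rewrite (cardsD1 u) !inE vu eqxx.
rewrite !inE => /and3P[wu vw /eqP fw].
have /card_gt0P[x] : 0 < #|colour_neighbours f u (f v) :\ v|.
  by move: lt1u; rewrite (cardsD1 v) !inE uv eqxx.
rewrite !inE => /and3P[xv ux /eqP fx].
have fuv := fP4 _ _ uv.
have xu : adj x u by rewrite adj_sym.
have neq_of_f (a b : G) : f a != f b -> a != b.
  by apply: contraNneq => ->.
apply: (fP x u v w).
  rewrite /is_P4 /= !inE !negb_or xu uv vw xv (eq_sym u w) wu.
  by rewrite !neq_of_f ?fx ?fw // eq_sym.
have /subset_leq_card/leq_trans : [set f y | y in [:: x; u; v; w]] \subset
    [set f u; f v].
  apply/subsetP => _ /imsetP[y y4 ->]; move: y4; rewrite !inE.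
  by case/or4P=> /eqP->; rewrite ?fx ?fw eqxx ?orbT.
by apply; rewrite cards2; case: (_ != _).
Qed.

Section UniquelySeen.

Context {p : nat} {G : sgraph} {f : G -> 'I_p.+2}.
Hypotheses (hp : 2 <= p) (hreg : regular (2 * p) G) (fS : star_colouring f).

(** A set of neighbours rather than of colours, so that edges can be counted; [f] is injective on
    it, so both counts agree. *)
Definition uniquely_seen (v : G) : {set G} :=
  [set u in neighbours v | #|colour_neighbours f v (f u)| == 1].

Lemma uniquely_seen_inj {v} : {in uniquely_seen v &, injective f}.
Proof.
move=> u w; rewrite !inE => /andP[vu /cards1P[x cx]] /andP[vw _] fuw.
have : u \in colour_neighbours f v (f u) by rewrite !inE vu eqxx.
have : w \in colour_neighbours f v (f u) by rewrite !inE vw fuw eqxx.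
by rewrite cx !inE => /eqP-> /eqP->.
Qed.

Lemma uniquely_seen_colours v :
  f @: uniquely_seen v \subset [set~ f v].
Proof.
apply/subsetP => _ /imsetP[u u1 ->]; move: u1; rewrite !inE => /andP[vu _].
by rewrite eq_sym; apply: fS.1.
Qed.

Lemma mem_uniquely_seen {v u} :
  u \in neighbours v -> (u \in uniquely_seen v) = (f u \in f @: uniquely_seen v).
Proof.
move=> vu; apply/idP/imsetP => [u1|[w w1 fuw]]; first by exists u.
by move: w1; rewrite !inE fuw => /andP[_ ->]; rewrite inE in vu; rewrite vu.
Qed.

(** With [p.+1] such neighbours, every colour other than [f v] would occur exactly once around [v],
    and the degree would be [p.+1 < 2 * p]. *)
Lemma card_uniquely_seen_le v : #|uniquely_seen v| <= p.
Proof.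
rewrite leqNgt; apply/negP => lt_p.
have fE : f @: uniquely_seen v = [set~ f v].
  apply/eqP; rewrite eqEcard uniquely_seen_colours cardsC1 card_ord.
  by rewrite card_in_imset //; apply: uniquely_seen_inj.
have nE : neighbours v \subset uniquely_seen v.
  apply/subsetP => u vu; rewrite mem_uniquely_seen // fE !inE eq_sym.
  by apply: fS.1; rewrite inE in vu.
have := subset_leq_card nE; rewrite hreg.
rewrite -(card_in_imset (@uniquely_seen_inj v)) fE cardsC1 card_ord; lia.
Qed.

Lemma edge_uniquely_seen {v u} :
  adj v u -> (u \in uniquely_seen v) || (v \in uniquely_seen u).
Proof.
move=> vu; have uv : adj u v by rewrite adj_sym.
rewrite !inE vu uv /= !eqn_leq !card_gt0.
have -> : colour_neighbours f v (f u) != set0.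
  by apply/set0Pn; exists u; rewrite !inE vu eqxx.
have -> : colour_neighbours f u (f v) != set0.
  by apply/set0Pn; exists v; rewrite !inE uv eqxx.
by rewrite !andbT; apply/orP; apply: star_colouring_edge.
Qed.

(** Let [e] be the indicator of being uniquely seen. Summing [adj v u <= e v u + e u v] over all
    pairs bounds [2 * p * #|G|] by twice the sum of the [#|uniquely_seen v|], which is again at most
    [2 * p * #|G|]. So every inequality used is an equality. *)
Lemma uniquely_seen_tight :
  (forall v, #|uniquely_seen v| = p) /\
  (forall v u, adj v u -> u \in uniquely_seen v -> v \notin uniquely_seen u).
Proof.
pose e (v u : G) : nat := u \in uniquely_seen v.
have sum_e v : \sum_u e v u = #|uniquely_seen v|.
  by rewrite -sum1_card [RHS]big_mkcond; apply: eq_bigr => u _; rewrite /e; case: ifP.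
have sum_adj (v : G) : \sum_(u : G) (adj v u : nat) = 2 * p.
  rewrite -(hreg v) -sum1_card [RHS]big_mkcond.
  by apply: eq_bigr => u _; rewrite inE; case: ifP.
have le_e (v u : G) : adj v u <= e v u + e u v.
  case vu: (adj v u) => //; have := edge_uniquely_seen vu.
  by rewrite /e; case: (u \in _); case: (v \in _).
have sum2 v : \sum_u (e v u + e u v) = \sum_u e v u + \sum_u e u v.
  by rewrite big_split.
have total : \sum_v \sum_u (e v u + e u v) = 2 * \sum_v #|uniquely_seen v|.
  rewrite (eq_bigr _ (fun v _ => sum2 v)) big_split /=.
  by rewrite [X in _ + X]exchange_big /= addnn -mul2n (eq_bigr _ (fun v _ => sum_e v)).
have card_le : \sum_v #|uniquely_seen v| <= \sum_(v : G) p.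
  by apply: leq_sum => v _; apply: card_uniquely_seen_le.
have total_adj : \sum_(v : G) \sum_(u : G) (adj v u : nat) = 2 * \sum_(v : G) p.
  by rewrite (eq_bigr _ (fun v _ => sum_adj v)) big_distrr.
have adj_le : \sum_(v : G) \sum_(u : G) (adj v u : nat) <= \sum_v \sum_u (e v u + e u v).
  by apply: leq_sum => v _; apply: leq_sum => u _.
split=> [v|v u vu].
  by apply: (eq_of_leq_sum _ _ card_uniquely_seen_le); lia.
(* Equality of the double sums descends first to each row, then to each entry of the row. *)
have row (v' : G) : \sum_(u : G) (adj v' u : nat) = \sum_u (e v' u + e u v').
  apply: (eq_of_leq_sum (fun v' => \sum_(u : G) (adj v' u : nat))
            (fun v' => \sum_u (e v' u + e u v'))); last by lia.
  by move=> w; apply: leq_sum => u' _.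
have : (adj v u : nat) = e v u + e u v.
  apply: (eq_of_leq_sum (fun u => adj v u : nat) (fun u => e v u + e u v)) => //.
  by rewrite row.
by rewrite vu /e; case: (u \in _); case: (v \in _).
Qed.

(** The [p] uniquely seen colours miss exactly one of the [p.+1] colours other than [f v]; all of
    the remaining [2 * p - p] neighbours must carry it. *)
Lemma repeated_colour v :
  exists s : 'I_p.+2, [/\ f v != s, #|colour_neighbours f v s| = p &
    forall k, k \notin [:: f v; s] -> #|colour_neighbours f v k| = 1].
Proof.
have card_p := uniquely_seen_tight.1 v.
have card_im : #|f @: uniquely_seen v| = p.
  by rewrite card_in_imset //; apply: uniquely_seen_inj.
have /cards1P[s sE] : #|[set~ f v] :\: f @: uniquely_seen v| == 1.
  rewrite cardsDS ?uniquely_seen_colours // cardsC1 card_ord card_im.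
  by rewrite subSnn.
have mem_s k : (k == s) = (k \notin f @: uniquely_seen v) && (k != f v).
  by rewrite -in_set1 -sE !inE.
have := mem_s s; rewrite eqxx => /esym/andP[s_im s_fv].
exists s; split; first by rewrite eq_sym.
  have -> : colour_neighbours f v s = neighbours v :\: uniquely_seen v.
    apply/setP => u; rewrite in_setD [in LHS]inE.
    case vu: (u \in neighbours v); last by rewrite andbF.
    rewrite mem_uniquely_seen // mem_s andbT /=.
    rewrite inE in vu.
    by rewrite [f u == f v]eq_sym fS.1 // andbT.
  rewrite cardsDS; last by apply/subsetP => u; rewrite inE => /andP[].
  by rewrite hreg card_p mul2n -addnn addnK.
move=> k; rewrite !inE negb_or mem_s => /andP[-> /=].
rewrite andbT negbK => /imsetP[u u1 ->].
by move: u1; rewrite inE => /andP[_ /eqP].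
Qed.

End UniquelySeen.

Arguments uniquely_seen {p G} f v.

(** * Star colourings, labellings and partitions *)

(* The labels [f v = i] and [s v = j] encode that [v] lies in [V i j]. *)
Definition star_labelling (p : nat) (G : sgraph) (f s : G -> 'I_p.+2) : Prop :=
  forall v, [/\ f v != s v,
    #|[set u in neighbours v | (f u == s v) && (s u != f v)]| = p &
    forall k, k \notin [:: f v; s v] ->
      #|[set u in neighbours v | (f u == k) && (s u == f v)]| = 1].

(** Take for [s v] the repeated colour at [v]. Each edge is uniquely seen from exactly one end, so
    exactly one of [f u = s v] and [s u = f v] holds across it; this gives the conditions on [s u]
    that [repeated_colour] leaves open. *)
Lemma colouring_labelling {p : nat} {G : sgraph} {f : G -> 'I_p.+2} :
  2 <= p -> regular (2 * p) G -> star_colouring f ->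
  exists s : G -> 'I_p.+2, star_labelling p G f s.
Proof.
move=> hp hreg fS.
have [s sP] := fin_all_exists (repeated_colour hp hreg fS).
have cs v u : adj v u -> (u \in uniquely_seen f v) = (f u != s v).
  move=> vu; have [fsv cp c1] := sP v.
  have fuv := fS.1 _ _ vu; rewrite !inE vu /=.
  (* The colour [s v] occurs [p] times around [v], and [p] is not 1. *)
  have [->|fus] := eqVneq (f u) (s v); first by rewrite cp; apply: gtn_eqF.
  by rewrite c1 // !inE negb_or fus eq_sym fuv.
have opp v u : adj v u -> f u != s v -> s u = f v.
  move=> vu; rewrite -cs //.
  move=> u1; have := (uniquely_seen_tight hp hreg fS).2 _ _ vu u1.
  by rewrite cs 1?adj_sym // negbK => /eqP.
have same v u : adj v u -> f u = s v -> s u != f v.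
  move=> vu fus; have : u \notin uniquely_seen f v by rewrite cs // fus eqxx.
  have := edge_uniquely_seen fS vu.
  by case: (u \in _) => //=; rewrite cs 1?adj_sym // eq_sym => ->.
exists s => v; have [fsv cp c1] := sP v; split=> // [|k].
  rewrite -[RHS]cp; apply: eq_card => u; rewrite !inE.
  case vu: (adj v u) => //=; case: eqP => //= /(same _ _ vu) -> //.
move=> kfs; rewrite -[RHS](c1 k kfs); apply: eq_card => u; rewrite !inE.
case vu: (adj v u) => //=; case: eqP => //= fuk.
apply/eqP/(opp _ _ vu); rewrite fuk.
by move: kfs; rewrite !inE negb_or => /andP[].
Qed.

(** The two kinds of neighbours are disjoint and number [p] each, the second with one for every
    colour outside [f v] and [s v]. By regularity they exhaust the neighbourhood. *)
Lemma labelling_edge {p : nat} {G : sgraph} {f s : G -> 'I_p.+2} :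
  regular (2 * p) G -> star_labelling p G f s -> forall v u, adj v u ->
  (f u == s v) && (s u != f v) ||
  (f u \notin [:: f v; s v]) && (s u == f v).
Proof.
move=> hreg fsP v u vu; have [fsv cp c1] := fsP v.
set D := [set u in neighbours v | (f u == s v) && (s u != f v)] in cp.
pose E := [set u in neighbours v | (f u \notin [:: f v; s v]) && (s u == f v)].
have cE : #|E| = p.
  rewrite (card_partition_sum f) -[RHS](card_ord_neq2 fsv) -sum1_card.
  rewrite [RHS]big_mkcond; apply: eq_bigr => k _; rewrite inE.
  case: ifPn => [kfs|/negbNE kfs].
    rewrite -[RHS](c1 k kfs); apply: eq_card => w; rewrite !inE.
    have [fwk|] := eqVneq (f w) k; last by rewrite !andbF.
    by rewrite andbT; move: kfs; rewrite -fwk !inE => ->.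
  apply/eqP; rewrite cards_eq0 -subset0; apply/subsetP => w; rewrite !inE.
  by case/andP=> /and3P[_ nfw _] /eqP fw; move: kfs; rewrite -fw !inE (negPf nfw).
have DE : [disjoint D & E].
  rewrite disjoints_subset; apply/subsetP => w; rewrite !inE.
  by case/and3P=> _ _ /negPf->; rewrite !andbF.
have nE : D :|: E = neighbours v.
  apply/eqP; rewrite eqEcard hreg cardsU disjoint_setI0 // cards0 subn0 cp cE.
  rewrite mul2n addnn leqnn andbT; apply/subsetP => w; rewrite !inE.
  by case/orP=> /andP[].
have : u \in D :|: E by rewrite nE inE.
by rewrite !inE vu.
Qed.

(** On a bicoloured path [a b c d] the inner vertices each have two neighbours of one colour, whence
    [s b = f c] and [s c = f b]. Both alternatives of [labelling_edge] exclude this for the edge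
    [bc]. *)
Lemma labelling_colouring {p : nat} {G : sgraph} {f s : G -> 'I_p.+2} :
  regular (2 * p) G -> star_labelling p G f s -> star_colouring f.
Proof.
move=> hreg fsP; have edgeP := labelling_edge hreg fsP.
have fcol : colouring f.
  move=> u v uv; have [fsu _ _] := fsP u.
  case/orP: (edgeP _ _ uv) => /andP[]; first by move/eqP->.
  by rewrite !inE negb_or eq_sym => /andP[].
(* A vertex [b] with two neighbours of one colour has that colour as [s b]. *)
have mid a b c : adj a b -> adj b c -> a != c -> f a = f c -> s b = f c.
  move=> ab bc ac fac; have ba : adj b a by rewrite adj_sym.
  case/orP: (edgeP _ _ bc) => /andP[]; first by move/eqP.
  move=> fc sc; have [_ _ /(_ _ fc)/eqP/cards1P[x xE]] := fsP b.
  case/orP: (edgeP _ _ ba) => /andP[]; first by move/eqP; rewrite fac.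
  move=> fa sa.
  have : a \in [set x] by rewrite -xE !inE ba fac eqxx.
  have : c \in [set x] by rewrite -xE !inE bc eqxx.
  by rewrite !inE => /eqP cx /eqP ax; rewrite ax cx eqxx in ac.
split=> // a b c d /andP[abcd] /= /and4P[ab bc cd _] two.
move: abcd; rewrite /= !inE !negb_or => /and4P[/and3P[_ ac _] /andP[_ bd] _ _].
(* With only two colours on the path, two vertices whose colours both differ from that of a third
   share a colour. *)
have sub3 x y z : x \in [:: a; b; c; d] -> y \in [:: a; b; c; d] ->
    z \in [:: a; b; c; d] -> f x != f y -> f y != f z -> f x = f z.
  move=> xa ya za xy yz; apply/eqP/negPn/negP => xz.
  suff : 3 <= 2 by [].
  apply: leq_trans two; have <- : #|[set f x; f y; f z]| = 3.
    by rewrite setUC cardsU1 cards2 !inE negb_or xy !(eq_sym (f z)) xz yz.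
  apply: subset_leq_card; apply/subsetP => i; rewrite !inE -orbA.
  by case/or3P=> /eqP->; apply: imset_f.
have fac : f a = f c.
  by apply: (sub3 a b c); rewrite ?inE ?eqxx ?orbT ?fcol.
have fbd : f b = f d.
  by apply: (sub3 b c d); rewrite ?inE ?eqxx ?orbT ?fcol.
have sb := mid _ _ _ ab bc ac fac.
have sc := mid _ _ _ bc cd bd fbd.
by case/orP: (edgeP _ _ bc); rewrite sb sc fbd ?inE !eqxx ?orbT.
Qed.

Lemma labelling_partition {p : nat} {G : sgraph} {f s : G -> 'I_p.+2} :
  star_labelling p G f s ->
  star_partition (fun i j => [set v | (f v == i) && (s v == j)]).
Proof.
move=> fsP; split; first split.
- move=> i j i' j' _ _; apply: contraNT => /pred0Pn[v] /=.
  by rewrite !inE => /andP[/andP[/eqP<- /eqP<-] /andP[/eqP<- /eqP<-]].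
- apply/setP => v; rewrite inE; have [fsv _ _] := fsP v.
  by apply/bigcupP; exists (f v) => //; apply/bigcupP; exists (s v); rewrite ?inE ?eqxx.
move=> i j ij v; rewrite inE => /andP[/eqP<- /eqP<-].
have [fsv cp c1] := fsP v; split=> [|k kfs].
  rewrite -[RHS]cp; apply: eq_card => u; rewrite !inE; congr (_ && _).
  apply/bigcupP/andP => [[k]|[fu su]].
    rewrite !inE negb_or => /andP[kf _] /andP[-> /eqP->]; by [].
  (* The index [s u] differs from [s v = f u] because no label pair is diagonal. *)
  exists (s u); rewrite ?inE ?fu ?eqxx // negb_or su /= -(eqP fu) eq_sym.
  by have [] := fsP u.
by rewrite -[RHS](c1 k kfs); apply: eq_card => u; rewrite !inE.
Qed.

(** Covering and disjointness give each vertex a unique off-diagonal index pair, which serves as its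
    labels. The sets [V i i] are arbitrary, hence the restriction to [i != j]. *)
Lemma partition_labelling {p : nat} {G : sgraph} {V : 'I_p.+2 -> 'I_p.+2 -> {set G}} :
  star_partition V ->
  exists f s : G -> 'I_p.+2, star_labelling p G f s /\
    forall i j, i != j -> V i j = [set v | (f v == i) && (s v == j)].
Proof.
case=> [[Vdis Vcov] VP].
have exV (v : G) : exists t : 'I_p.+2 * 'I_p.+2, (t.1 != t.2) && (v \in V t.1 t.2).
  have : v \in [set: G] by [].
  rewrite -Vcov => /bigcupP[i _ /bigcupP[j ij vij]].
  by exists (i, j); rewrite ij.
have [t tP] := fin_all_exists exV.
pose f v := (t v).1; pose s v := (t v).2.
have fs v : f v != s v by case/andP: (tP v).
have Vfs v : v \in V (f v) (s v) by case/andP: (tP v).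
have VE i j : i != j -> V i j = [set v | (f v == i) && (s v == j)].
  move=> ij; apply/setP => v; rewrite inE.
  apply/idP/andP => [vij|[/eqP<- /eqP<-] //].
  apply/andP; rewrite -xpair_eqE; apply: contraLR vij => neq.
  by rewrite (disjointFr (Vdis _ _ _ _ (fs v) ij neq)).
exists f, s; split=> // v; have [cp c1] := VP _ _ (fs v) v (Vfs v).
split=> // [|k kfs].
  rewrite -[RHS]cp; apply: eq_card => u; rewrite !inE; congr (_ && _).
  apply/esym; apply/bigcupP/andP => [[k]|[fu su]].
    rewrite !inE negb_or => /andP[kf ks].
    by rewrite eq_sym in ks; rewrite VE // inE => /andP[-> /eqP->].
  exists (s u); last by rewrite -(eqP fu).
  by rewrite !inE negb_or su -(eqP fu) eq_sym fs.
rewrite -[RHS](c1 k kfs); apply: eq_card => u; rewrite !inE.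
by rewrite VE ?inE //; move: kfs; rewrite !inE negb_or => /andP[].
Qed.

(** * Cardinalities of the parts *)

Section Cardinalities.

Context {p : nat} {G : sgraph} {f s : G -> 'I_p.+2}.
Hypotheses (hp : 2 <= p) (fsP : star_labelling p G f s).

Let x (i j : 'I_p.+2) := #|[set v | (f v == i) && (s v == j)]|.
Let S (i : 'I_p.+2) := #|[set v | f v == i]|.

(** Double counting of the edges between [A], the vertices of colour [i] with second label other
    than [k], and [B], the part indexed by [k] and [i]: a vertex of [A] has one neighbour in [B], a
    vertex of [B] has [p] in [A]. *)
Lemma class_double_count i k : i != k -> S i = x i k + p * x k i.
Proof.
move=> ik; pose A := [set v | (f v == i) && (s v != k)].
pose B := [set v | (f v == k) && (s v == i)].
have SA : S i = x i k + #|A|.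
  rewrite /S -(cardsID [set v | s v == k]); congr (_ + _).
    by apply: eq_card => v; rewrite !inE.
  by apply: eq_card => v; rewrite !inE andbC.
rewrite SA; congr (_ + _).
transitivity (\sum_(v in A) #|[set u in B | adj v u]|).
  rewrite -sum1_card; apply: eq_bigr => v; rewrite inE => /andP[/eqP fv sv].
  have [_ _ /(_ k)] := fsP v; rewrite fv => <-; last first.
    by rewrite !inE negb_or eq_sym ik eq_sym.
  by apply: eq_card => u; rewrite !inE andbC.
rewrite exchange_card mulnC -sum_nat_const; apply: eq_bigr => u.
rewrite inE => /andP[/eqP fu /eqP su]; have [_ cp _] := fsP u.
rewrite -[RHS]cp; apply: eq_card => v.
by rewrite !inE fu su andbC adj_sym.
Qed.

Lemma class_sum i : S i = \sum_(j | j != i) x i j.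
Proof.
rewrite /S (card_partition_sum s) (bigD1 i) //= eq_card0 ?add0n.
  by apply: eq_bigr => j _; apply: eq_card => v; rewrite !inE.
move=> v; rewrite !inE; case: eqP => //= <-.
by rewrite eq_sym; apply/negbTE; have [] := fsP v.
Qed.

Lemma order_sum : #|G| = \sum_i S i.
Proof.
rewrite -cardsT (card_partition_sum f); apply: eq_bigr => i _.
by apply: eq_card => v; rewrite !inE.
Qed.

Lemma class_order i : #|G| = p.+2 * S i.
Proof.
(* Eliminating [x k i] from the equations for [(i, k)] and [(k, i)]. *)
have elim k : k != i -> p * S k + x i k = S i + p * p * x i k.
  move=> ki; have := class_double_count k i ki.
  have := class_double_count i k; rewrite eq_sym => /(_ ki); nia.
have : \sum_(k | k != i) (p * S k + x i k) =
       \sum_(k | k != i) (S i + p * p * x i k) by apply: eq_bigr.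
rewrite !big_split /= -!big_distrr /= -class_sum sum_nat_const.
rewrite cardC1 card_ord order_sum [in X in _ -> X](bigD1 i) //=.
set T := \sum_(_ | _) _ => eqT.
(* Here [T] is the total size of the other classes, and [eqT] amounts to
   [p * T + S i = p.+1 * S i + p * p * S i]; cancel [p]. *)
have -> : T = p.+1 * S i.
  by apply/eqP; rewrite -(eqn_pmul2l (ltnW hp)); apply/eqP; nia.
by rewrite -mulSn.
Qed.

(** All classes have the same size, so the equations for [(i, j)] and [(j, i)] give
    [x i j + p * x j i = x j i + p * x i j]. As [p] is not 1, [x i j = x j i], and then
    [S i = p.+1 * x i j]. *)
Lemma part_card i j : i != j -> #|G| = p.+1 * p.+2 * x i j.
Proof.
move=> ij; have Gi := class_order i; have Gj := class_order j.
have eqS : S i = S j by apply/eqP; rewrite -(eqn_pmul2l (ltn0Sn p.+1)) -Gi Gj.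
have := class_double_count i j ij.
have := class_double_count j i; rewrite eq_sym => /(_ ij) Sj Si.
have eqx : x i j = x j i by nia.
by rewrite Gi Si -eqx; nia.
Qed.

End Cardinalities.

Theorem theorem3 (p : nat) (hp : 2 <= p) (G : sgraph) (n : nat)
    (hn : #|G| = n) (hreg : regular (2 * p) G) :
  (star_colourable p.+2 G <->
     exists V : 'I_p.+2 -> 'I_p.+2 -> {set G}, star_partition V) /\
  (forall V : 'I_p.+2 -> 'I_p.+2 -> {set G}, star_partition V ->
     (forall i j i' j' : 'I_p.+2, i != j -> i' != j' ->
        #|V i j| = #|V i' j'|) /\
     p.+1 * p.+2 %| n).
Proof.
split; first split.
- case=> f /(colouring_labelling hp hreg)[s fsP].
  by exists (fun i j => [set v | (f v == i) && (s v == j)]); apply: labelling_partition.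
- case=> V /partition_labelling[f [s [fsP _]]].
  by exists f; apply: labelling_colouring fsP.
move=> V /partition_labelling[f [s [fsP VE]]]; split=> [i j i' j' ij ij'|].
  apply/eqP; rewrite -(eqn_pmul2l (isT : 0 < p.+1 * p.+2)) !VE //.
  by rewrite -!(part_card hp fsP).
(* Any off-diagonal pair of indices serves here. *)
by rewrite -hn (part_card hp fsP ord0 ord_max isT) dvdn_mulr.
Qed.
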